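(* For every rational number $r$ with $0<r<1$ there exists $u\in\mathbb{N}$ such that \[ \frac{s_2(u^2)}{s_2(u)}=r. \]
   Context: For $n\in\mathbb{N}$, $s_2(n)$ denotes the sum of the binary digits of $n$ (the number of $1$s in its binary expansion). *)

(* Defs.v *)
From mathcomp Require Import all_boot.

Set Implicit Arguments.
Unset Strict Implicit.
Unset Printing Implicit Defensive.

Definition bit2 (n i : nat) : nat := (n %/ 2 ^ i) %% 2.

(* Since n < 2 ^ n, all digits of weight 2 ^ i with i >= n vanish, so the range
   i < n covers every nonzero digit. *)
Definition s2 (n : nat) : nat := \sum_(i < n) bit2 n i.

(* Main.v *)
(** Let t = m x^4 + m x^3 - x^2 + m x + m. For m >= 2 every coefficient of t^2
    is nonnegative, so for x = 2 ^ k with k large the digit sum of t^2 is a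
    constant independent of k, while the single negative coefficient of t
    produces a run of k ones. With m = 2 ^ e.+1 one finds s2 (t^2) = 4 e + 8 and
    s2 t = k + e + 4 as soon as k >= 2 e + 5. For r = p / q take e = 2 p - 2, so
    that s2 (t^2) = 8 p, and choose k so that s2 t = 8 q; the bound on k follows
    from q > p. *)
Require Import Defs.
From mathcomp Require Import all_boot all_order all_algebra.
From mathcomp Require Import zify ring.

Set Implicit Arguments.
Unset Strict Implicit.
Unset Printing Implicit Defensive.

Import Order.TTheory GRing.Theory Num.Theory.
Local Open Scope ring_scope.

Section DigitSums.
Local Open Scope nat_scope.

Lemma s2_widen n N : n <= N -> s2 n = \sum_(i < N) bit2 n i.
Proof.
move=> leNn; rewrite /s2 -!(big_mkord predT (bit2 n)).
rewrite (big_cat_nat (leq0n n) leNn) /= [X in _ = _ + X]big_nat.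
rewrite [X in _ = _ + X]big1 ?addn0 // => i /andP[leni _].
rewrite /bit2 divn_small ?mod0n //.
exact: leq_ltn_trans leni (ltn_expl i (isT : 1 < 2)).
Qed.

Lemma s2_bit (b : bool) n : s2 (b + 2 * n) = b + s2 n.
Proof.
have half : (b + 2 * n) %/ 2 = n by case: b; lia.
(* The two ranges are aligned so that removing digit 0 on the left matches the sums term by term. *)
rewrite (@s2_widen _ (b + 2 * n).+1) // (@s2_widen n (b + 2 * n)); last by lia.
rewrite big_ord_recl {1}/bit2 expn0 divn1; congr (_ + _).
  by case: b {half}; lia.
by apply: eq_bigr => i _; rewrite lift0 /bit2 expnS divnMA half.
Qed.

Lemma s2_0 : s2 0 = 0. Proof. by rewrite /s2 big_ord0. Qed.

(** The digits of [a] lie below position [k] and those of [2 ^ k * b] from [k] on, so no carry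
    occurs. *)
Lemma s2_block k a b : a < 2 ^ k -> s2 (a + 2 ^ k * b) = s2 a + s2 b.
Proof.
elim: k a => [|k IHk] a.
  by case: a => // _; rewrite mul1n s2_0.
rewrite expnS => lta.
have def_a : a = odd a + 2 * a./2 by rewrite mul2n odd_double_half.
have -> : a + 2 * 2 ^ k * b = odd a + 2 * (a./2 + 2 ^ k * b) by lia.
by rewrite s2_bit IHk ?[in s2 a]def_a ?s2_bit ?addnA //; lia.
Qed.

Lemma s2_shift k b : s2 (2 ^ k * b) = s2 b.
Proof. by rewrite -[_ * b]add0n s2_block ?expn_gt0 // s2_0. Qed.

Lemma s2_pow k : s2 (2 ^ k) = 1.
Proof. by rewrite -[2 ^ k]muln1 s2_shift (s2_bit true 0) s2_0. Qed.

Lemma s2_pow_pred k : s2 (2 ^ k - 1) = k.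
Proof.
elim: k => [|k IHk]; first exact: s2_0.
have k_gt0 : 0 < 2 ^ k by rewrite expn_gt0.
have -> : 2 ^ k.+1 - 1 = true + 2 * (2 ^ k - 1) by rewrite expnS /=; lia.
by rewrite s2_bit IHk.
Qed.

(** Horner form of t after the borrow m x^3 - x^2 = (m - 1) x^3 + (x - 1) x^2, which makes all
    base-[x] digits natural. *)
Definition quartic (m x : nat) : nat :=
  m + x * (m + x * ((x - 1) + x * ((m - 1) + x * m))).

Lemma s2_quartic e k : 2 * e + 5 <= k ->
  s2 (quartic (2 ^ e.+1) (2 ^ k)) = k + e + 4.
Proof.
move=> lek.
have ltm : 2 ^ e.+1 < 2 ^ k by rewrite ltn_exp2l //; lia.
rewrite /quartic !s2_block ?s2_pow ?s2_pow_pred //; lia.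
Qed.

Lemma quartic_sqr m x : 1 < m -> 0 < x ->
  quartic m x ^ 2 =
    m ^ 2 + x * (2 * m ^ 2 + x * (m * (m - 2) + x * (2 * m * (m - 1)
    + x * ((1 + 4 * m ^ 2) + x * (2 * m * (m - 1) + x * (m * (m - 2)
    + x * (2 * m ^ 2 + x * m ^ 2))))))).
Proof.
case: m => [|[|m]] // _; case: x => [|x] // _.
by rewrite /quartic !subn1 subn2 /=; ring.
Qed.

Lemma s2_quartic_sqr e k : 2 * e + 5 <= k ->
  s2 (quartic (2 ^ e.+1) (2 ^ k) ^ 2) = 4 * e + 8.
Proof.
move=> lek; set m := 2 ^ e.+1.
have m_gt1 : 1 < m by rewrite -[1](expn0 2) ltn_exp2l.
have msq : m ^ 2 = 2 ^ (2 * e + 2) by rewrite -expnM; congr (_ ^ _); lia.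
(* The largest coefficient of the square, 1 + 4 m^2, is below 8 m^2 = 2^(2e+5); hence the bound on
   [k]. *)
have ltk : 8 * m ^ 2 <= 2 ^ k.
  by rewrite msq -[8]/(2 ^ 3) -expnD leq_exp2l //; lia.
have s_m2 : s2 (m ^ 2) = 1 by rewrite msq s2_pow.
have s_2m2 : s2 (2 * m ^ 2) = 1 by rewrite msq -expnS s2_pow.
have s_mm2 : s2 (m * (m - 2)) = e.
  have -> : m - 2 = 2 ^ 1 * (2 ^ e - 1) by rewrite /m expnS mulnBr.
  by rewrite !s2_shift s2_pow_pred.
have s_2mm1 : s2 (2 * m * (m - 1)) = e.+1.
  by rewrite -expnS s2_shift s2_pow_pred.
have s_4m2 : s2 (1 + 4 * m ^ 2) = 2.
  rewrite -[4]/(2 ^ 2) s2_block // s_m2.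
  by rewrite (s2_pow 0).
(* The nine blocks contribute 2 (1 + 1 + e + (e + 1)) + 2. *)
rewrite quartic_sqr ?expn_gt0 // !s2_block; nia.
Qed.

End DigitSums.

Theorem theorem2p2 (r : rat) (hr0 : 0 < r) (hr1 : r < 1) :
  exists u : nat, (s2 (u ^ 2)%N)%:R / (s2 u)%:R = r :> rat.
Proof.
have [p [q [p_gt0 ltpq ->]]] :
    exists p q : nat, [/\ (0 < p)%N, (p < q)%N & r = p%:R / q%:R].
  exists `|numq r|%N, `|denq r|%N.
  have num_gt0 : 0 < numq r by rewrite numq_gt0.
  have den_gt0 := denq_gt0 r.
  have lt_num_den : numq r < denq r.
    move: hr1; rewrite -{1}(divq_num_den r) ltr_pdivrMr ?ltr0z //.
    by rewrite mul1r ltr_int.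
  split; [lia | lia |].
  by rewrite -{1}(divq_num_den r) !natr_absz !gtr0_norm.
(* Scaling by 8 rather than 4 keeps [e] nonnegative: 4 e + 8 = 4 p has no natural solution when p =
   1. *)
pose e := (2 * p - 2)%N; pose k := (8 * q - 2 * p - 2)%N.
have lek : (2 * e + 5 <= k)%N by rewrite /e /k; lia.
exists (quartic (2 ^ e.+1) (2 ^ k)); rewrite s2_quartic_sqr // s2_quartic //.
have -> : (4 * e + 8 = 8 * p)%N by rewrite /e; lia.
have -> : (k + e + 4 = 8 * q)%N by rewrite /e /k; lia.
by rewrite !natrM -mulf_div divff ?mul1r // pnatr_eq0.
Qed.
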